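(* Let $(W,\Sigma)$ be a Coxeter system, $Q=(\sigma_1,\ldots,\sigma_n)$ a word in $W$, $\pi\in W$, and let $\Delta$ be the subword complex $\Delta(Q,\pi)$. Let $G(I_{\Delta^\vee})=\{\mathbf x_{P_1},\ldots,\mathbf x_{P_r}\}$, where $\mathbf x_{P_1}>_{lex}\cdots>_{lex}\mathbf x_{P_r}$. Then $Q\setminus P_1,\ldots,Q\setminus P_r$ is a shelling order on the facets of $\Delta$.
   Context: $\Sigma$ is the set of simple reflections of the Coxeter group $W$. A word $Q=(\sigma_1,\ldots,\sigma_n)$ of size $n$ is an ordered sequence of elements of $\Sigma$; a subword $P=(\sigma_{i_1},\ldots,\sigma_{i_m})$, $i_1<\cdots<i_m$, is an ordered subsequence (identified with its set of positions $\{i_1,\ldots,i_m\}$). $P$ represents $\pi$ if the ordered product of the simple reflections in $P$ is a reduced expression for $\pi$; $P$ contains $\pi$ if some subsequence of $P$ represents $\pi$. The subword complex $\Delta(Q,\pi)$ is the set of subwords $Q\setminus P$ such that $P$ contains $\pi$; it is a pure simplicial complex whose facets are the $Q\setminus P$ with $P$ representing $\pi$. For $P=(\sigma_{i_1},\ldots,\sigma_{i_m})$ put $\mathbf x_P=x_{i_1}\cdots x_{i_m}\in k[x_1,\ldots,x_n]$, $k$ a field. The Stanley--Reisner ideal of the Alexander dual of $\Delta$ is $I_{\Delta^\vee}=(\mathbf x_P: P\subseteq Q,\ P\text{ represents }\pi)$, and $G(I_{\Delta^\vee})$ is its minimal monomial generating set. The lexicographic order is taken with $x_1>\cdots>x_n$.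 A linear order $F_1,\ldots,F_r$ of the facets of a pure simplicial complex is a shelling if for all $1\le j<i\le r$ there exist $v\in F_i\setminus F_j$ and $t\in\{1,\ldots,i-1\}$ with $F_i\setminus F_t=\{v\}$. *)

(* Defs.v *)
From HB Require Import structures.
From mathcomp Require Import all_boot all_order all_fingroup all_algebra.
From mathcomp Require Import mpoly.

Set Implicit Arguments.
Unset Strict Implicit.
Unset Printing Implicit Defensive.

Import Order.TTheory GRing.Theory.
Local Open Scope ring_scope.

Definition is_word (W : groupType) (Sigma : W -> Prop) (w : seq W) : Prop :=
  forall s, s \in w -> Sigma s.

Definition word_prod (W : groupType) (w : seq W) : W :=
  (\prod_(s <- w) s)%g.

(* [m s t = 0] encodes m(s,t) = oo, i.e. no relation between s and t.
   The other values off the diagonal are then at least 2. *)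
Definition coxeter_matrix (W : groupType) (Sigma : W -> Prop)
    (m : W -> W -> nat) : Prop :=
  forall s t, Sigma s -> Sigma t ->
    m s t = m t s /\ (m s t = 1%N <-> s = t).

(* Equality of words in the group presented by Sigma and the relators
   (s t)^m(s,t): the equivalence generated by insertion and deletion of
   relators. Formal inverses of letters are not needed, because the relators
   (s s)^1 make each generator its own inverse. *)
Inductive coxeter_equiv (W : groupType) (Sigma : W -> Prop)
    (m : W -> W -> nat) : seq W -> seq W -> Prop :=
| CoxeterRelator u v s t : Sigma s -> Sigma t -> m s t <> 0%N ->
    coxeter_equiv Sigma m (u ++ flatten (nseq (m s t) [:: s; t]) ++ v) (u ++ v)
| CoxeterRefl u : coxeter_equiv Sigma m u u
| CoxeterSym u v : coxeter_equiv Sigma m u v -> coxeter_equiv Sigma m v u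
| CoxeterTrans u v w : coxeter_equiv Sigma m u v -> coxeter_equiv Sigma m v w ->
    coxeter_equiv Sigma m u w.

(* W = < Sigma | (s t)^m(s,t) = 1 for m(s,t) < oo >; Sigma may be infinite. *)
Definition coxeter_system (W : groupType) (Sigma : W -> Prop) : Prop :=
  exists m : W -> W -> nat,
    [/\ coxeter_matrix Sigma m,
        forall x, exists2 w, is_word Sigma w & word_prod w = x
      & forall u v, is_word Sigma u -> is_word Sigma v ->
          (word_prod u = word_prod v <-> coxeter_equiv Sigma m u v)].

Definition reduced_expression (W : groupType) (Sigma : W -> Prop)
    (w : seq W) (x : W) : Prop :=
  [/\ is_word Sigma w, word_prod w = x
    & forall v, is_word Sigma v -> word_prod v = x -> (size w <= size v)%N].

(* A subword is identified with its set of positions, numbered from 0;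
   [enum P] lists the positions in increasing order. *)
Definition subword (W : groupType) (n : nat) (Q : n.-tuple W)
    (P : {set 'I_n}) : seq W :=
  [seq tnth Q i | i <- enum P].

Definition represents (W : groupType) (Sigma : W -> Prop) (n : nat)
    (Q : n.-tuple W) (P : {set 'I_n}) (pi : W) : Prop :=
  reduced_expression Sigma (subword Q P) pi.

Definition contains (W : groupType) (Sigma : W -> Prop) (n : nat)
    (Q : n.-tuple W) (P : {set 'I_n}) (pi : W) : Prop :=
  exists2 P' : {set 'I_n}, P' \subset P & represents Sigma Q P' pi.

(* A complex is given by its set of faces; the void complex is allowed. *)
Definition simplicial_complex (T : finType) (Delta : {set T} -> Prop) : Prop :=
  forall F G : {set T}, Delta G -> F \subset G -> Delta F.

Definition facet (T : finType) (Delta : {set T} -> Prop) (F : {set T}) : Prop :=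
  Delta F /\ forall G : {set T}, Delta G -> F \subset G -> G = F.

Definition pure (T : finType) (Delta : {set T} -> Prop) : Prop :=
  forall F G : {set T}, facet Delta F -> facet Delta G -> #|F| = #|G|.

Definition shelling (T : finType) (Delta : {set T} -> Prop)
    (Fs : seq {set T}) : Prop :=
  [/\ simplicial_complex Delta, pure Delta,
      uniq Fs /\ (forall F, F \in Fs <-> facet Delta F)
    & forall i j, (j < i < size Fs)%N ->
        exists v t, [/\ v \in nth set0 Fs i :\: nth set0 Fs j, (t < i)%N
                      & nth set0 Fs i :\: nth set0 Fs t = [set v]]].

Definition alexander_dual (T : finType) (Delta : {set T} -> Prop)
    (F : {set T}) : Prop :=
  ~ Delta (~: F).

Definition subword_complex (W : groupType) (Sigma : W -> Prop) (n : nat)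
    (Q : n.-tuple W) (pi : W) (F : {set 'I_n}) : Prop :=
  exists2 P : {set 'I_n}, contains Sigma Q P pi & F = ~: P.

Definition monomial_ideal (k : fieldType) (n : nat) (M : 'X_{1..n} -> Prop)
    (f : {mpoly k[n]}) : Prop :=
  exists c : seq ({mpoly k[n]} * 'X_{1..n}),
    (forall p, p \in c -> M p.2) /\ f = \sum_(p <- c) p.1 * 'X_[p.2].

(* [mesym1 F] is the exponent vector of the squarefree monomial x_F. *)
Definition stanley_reisner (k : fieldType) (n : nat)
    (Delta : {set 'I_n} -> Prop) : {mpoly k[n]} -> Prop :=
  monomial_ideal (fun m => exists2 F : {set 'I_n}, ~ Delta F & m = mesym1 F).

Arguments stanley_reisner k {n} Delta _.

Definition minimal_monomial_generators (k : fieldType) (n : nat)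
    (I : {mpoly k[n]} -> Prop) (M : 'X_{1..n} -> Prop) : Prop :=
  (forall f, I f <-> monomial_ideal M f) /\
  forall M' : 'X_{1..n} -> Prop, (forall m, M' m -> M m) ->
    (forall f, I f <-> monomial_ideal M' f) -> forall m, M m -> M' m.

(* Pure lexicographic order with x_1 > ... > x_n; the canonical order of
   'X_{1..n} compares degrees first. *)
Definition lex_gt (n : nat) (m1 m2 : 'X_{1..n}) : bool :=
  ((multinom_val m2 : n.-tuplelexi nat) < multinom_val m1)%O.

(* Main.v *)
(* The minimal generators of the ideal are the x_P with P representing pi.
   If P' precedes P in lexicographic order and v is the first position where
   they differ, then v lies in P' only. Past the common prefix a, P' continues
   with v :: c and P with b, and the letter at v shortens the element
   represented by b, so by the exchange condition b loses a letter w when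
   multiplied by that letter. Then v |: P :\ w also represents pi, precedes P
   since v < w, and exceeds P in v only. The exchange condition is derived from
   the presentation by counting modulo 2 the occurrences of a reflection in the
   sequence s1, s1 s2 s1, s1 s2 s3 s2 s1, ... attached to a word. *)
Require Import Defs.
From mathcomp Require Import all_boot all_order all_fingroup all_algebra.
From mathcomp Require Import mpoly zify.
From Stdlib Require Import Classical.

Set Implicit Arguments.
Unset Strict Implicit.
Unset Printing Implicit Defensive.

Import GRing.Theory.

(** * Products of words and their reflection sequences *)

Lemma word_prod_nil (W : groupType) : word_prod [::] = 1%g :> W.
Proof. exact: big_nil. Qed.

Lemma word_prod_cons (W : groupType) (s : W) (w : seq W) :
  word_prod (s :: w) = (s * word_prod w)%g.
Proof. exact: big_cons. Qed.

Lemma word_prod_cat (W : groupType) (u v : seq W) :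
  word_prod (u ++ v) = (word_prod u * word_prod v)%g.
Proof. exact: big_cat. Qed.

(** Since [r ^ s^-1] is s r s^-1, the entry of the i-th letter is its conjugate p s_i p^-1, where p
    is the product of the letters before it. *)
Fixpoint reflections (W : groupType) (w : seq W) : seq W :=
  if w is s :: w' then s :: [seq (r ^ s^-1)%g | r <- reflections w'] else [::].

Lemma reflections_cat (W : groupType) (u v : seq W) :
  reflections (u ++ v) =
  reflections u ++ [seq (r ^ (word_prod u)^-1)%g | r <- reflections v].
Proof.
elim: u => [|s u IHu] /=.
  by rewrite word_prod_nil invg1 (eq_map (@conjg1 W)) map_id.
rewrite IHu map_cat -map_comp; congr (_ :: _ ++ _); apply: eq_map => r /=.
by rewrite word_prod_cons invgM conjgM.
Qed.

(** With p the product before the letter x, the entry p x p^-1 satisfies (p x p^-1)^-1 p x q = p q.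
    Letters are labelled by [I] so that a position can be deleted, not just a value. *)
Lemma deletion (W : groupType) (I : eqType) (f : I -> W) (w : seq I) (r : W) :
  r \in reflections (map f w) ->
  exists u x v, w = u ++ x :: v /\
    word_prod (map f (u ++ v)) = (r^-1 * word_prod (map f w))%g.
Proof.
elim: w r => [//|x w IHw] r /=; rewrite inE => /orP[/eqP->|].
  by exists [::], x, w; split; rewrite // word_prod_cons mulKg.
case/mapP => r' /IHw[u [y [v [-> e]]]] ->.
exists (x :: u), y, v; split=> //=.
by rewrite !word_prod_cons e conjgE !invgM !invgK -!mulgA mulKg.
Qed.

Lemma reflections_alternating (W : groupType) (s t : W) (k : nat) :
  (s * s)%g = 1%g -> (t * t)%g = 1%g ->
  reflections (flatten (nseq k [:: s; t])) =
  [seq ((s * t) ^+ i * s)%g | i <- iota 0 (k + k)].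
Proof.
move=> ss tt; elim: k => [//|k IHk].
have es : s^-1%g = s by exact: mulg1_eq.
have et : t^-1%g = t by exact: mulg1_eq.
rewrite addSn addnS /= IHk expg0 mul1g es conjgE es !mulgA.
congr [:: _, _ & _].
(* Conjugation past s t sends (s t)^i s to (s t)^(i+2) s. *)
rewrite (iotaDl 2 0) -!map_comp; apply: eq_map => i /=.
by rewrite !conjgE !invgK et es -[(2 + i)%N]/i.+2 expgS expgSr !mulgA.
Qed.

Lemma word_prod_alternating (W : groupType) (s t : W) (k : nat) :
  word_prod (flatten (nseq k [:: s; t])) = ((s * t) ^+ k)%g.
Proof.
elim: k => [|k IHk]; first exact: word_prod_nil.
by rewrite /= !word_prod_cons IHk expgS mulgA.
Qed.

(** * Parity of reflections in a Coxeter group *)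

Lemma coxeter_involution (W : groupType) (Sigma : W -> Prop) (s : W) :
  coxeter_system Sigma -> Sigma s -> (s * s)%g = 1%g.
Proof.
case=> m [hm _ hprod] hs; have [_ [_ m1]] := hm s s hs hs.
have [||_ e] := hprod [:: s; s] [::];
  try by move=> x; rewrite ?inE ?orbb // => /eqP->.
move: e; rewrite !word_prod_cons !word_prod_nil mulg1; apply.
(* The diagonal entry m(s,s) is 1, so the word s s is itself a relator. *)
by have := CoxeterRelator [::] [::] hs hs (m := m); rewrite m1 //; apply.
Qed.

(* A relator has order dividing m(s,t), so its sequence of reflections is the
   same block written twice: each reflection occurs in it an even number of
   times, and the parity of an occurrence count depends only on the element
   of the group. *)
Lemma odd_count_reflections (W : groupType) (Sigma : W -> Prop) (u v : seq W)
    (r : W) :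
  coxeter_system Sigma -> is_word Sigma u -> is_word Sigma v ->
  word_prod u = word_prod v ->
  odd (count_mem r (reflections u)) = odd (count_mem r (reflections v)).
Proof.
move=> hW hu hv; have [m [hm _ hprod]] := hW; move=> /hprod - /(_ hu hv).
elim=> {u v hu hv} [u v s t hs ht hst|//|u v _ -> //|u v w _ -> _ -> //].
have ss := coxeter_involution hW hs; have tt := coxeter_involution hW ht.
set k := m s t.
have stk : ((s * t) ^+ k)%g = 1%g.
  rewrite -word_prod_alternating -(word_prod_nil W); apply/hprod => //.
    move=> x /flattenP[y]; rewrite mem_nseq => /andP[_ /eqP->].
    by rewrite !inE => /orP[] /eqP->.
  by have := CoxeterRelator [::] [::] hs ht hst; rewrite cats0.
(* The relator has product 1, so the entries of [v] are conjugated alike in both words. *)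
rewrite !reflections_cat !map_cat !count_cat word_prod_alternating stk invg1.
rewrite (eq_map (@conjg1 W)) map_id reflections_alternating // iotaD map_cat.
rewrite add0n (_ : iota k k = map (addn k) (iota 0 k)); last first.
  by rewrite -iotaDl addn0.
rewrite -map_comp.
rewrite (_ : map (_ \o _) _ = [seq ((s * t) ^+ i * s)%g | i <- iota 0 k]).
  by rewrite map_cat !count_cat !oddD addbb.
by apply: eq_map => i /=; rewrite expgnDr stk mul1g.
Qed.

(** * Exchange on sets of positions *)

Lemma enum_set_filter (n : nat) (P : {set 'I_n}) :
  enum P = [seq i <- enum 'I_n | i \in P].
Proof. by rewrite enumT. Qed.

Lemma enum_ord_split (n : nat) (v : 'I_n) :
  exists s1 s2, [/\ enum 'I_n = s1 ++ v :: s2, {in s1, forall i : 'I_n, i < v}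
                  & {in s2, forall i : 'I_n, v < i}].
Proof.
have : pairwise ltn (map val (enum 'I_n)).
  by rewrite -(sorted_pairwise ltn_trans) val_enum_ord iota_ltn_sorted.
have : v \in enum 'I_n by rewrite mem_enum.
case/splitPr=> s1 s2; rewrite pairwise_map pairwise_cat /=.
case/and3P=> /allrelP h1 _ /andP[/allP h2 _]; exists s1, s2; split=> // i hi.
by apply: h1; rewrite ?mem_head.
Qed.

Lemma represents_exchange (W : groupType) (Sigma : W -> Prop) (n : nat)
    (Q : n.-tuple W) (pi : W) (P P' : {set 'I_n}) (v : 'I_n) :
  coxeter_system Sigma -> is_word Sigma Q ->
  represents Sigma Q P pi -> represents Sigma Q P' pi ->
  v \in P' -> v \notin P ->
  (forall i : 'I_n, i < v -> (i \in P) = (i \in P')) ->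
  exists w : 'I_n,
    [/\ w \in P, v < w & represents Sigma Q ((v |: P) :\ w) pi].
Proof.
move=> hW hQ hP hP' vP' vP eqPP'.
have hQi (s : seq 'I_n) : is_word Sigma (map (tnth Q) s).
  by move=> x /mapP[i _ ->]; apply/hQ/mem_tnth.
have [s1 [s2 [es lt1 lt2]]] := enum_ord_split v.
pose a := [seq i <- s1 | i \in P]; pose b := [seq i <- s2 | i \in P].
pose c := [seq i <- s2 | i \in P'].
have eP : enum P = a ++ b.
  by rewrite enum_set_filter es filter_cat /= (negbTE vP).
have eP' : enum P' = a ++ v :: c.
  rewrite enum_set_filter es filter_cat /= vP'; congr (_ ++ _).
  by apply: eq_in_filter => i /lt1/eqPP' ->.
have [_ prodP minP] := hP; have [_ prodP' minP'] := hP'.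
move: prodP prodP' minP minP'; rewrite /subword eP eP' !map_cat /=.
rewrite !word_prod_cat word_prod_cons => prodP prodP' minP minP'.
have ebc : word_prod (map (tnth Q) b) = word_prod (map (tnth Q) (v :: c)).
  by apply: (mulgI (word_prod (map (tnth Q) a))); rewrite prodP word_prod_cons.
have es' : (tnth Q v)^-1%g = tnth Q v.
  exact/mulg1_eq/(coxeter_involution hW)/hQ/mem_tnth.
have /= := odd_count_reflections (tnth Q v) hW (hQi b) (hQi (v :: c)) ebc.
(* Otherwise c, and hence P', would not be reduced. *)
have vc : tnth Q v \notin reflections (map (tnth Q) c).
  apply/negP => /deletion[u [x [y [ec e]]]].
  have := minP' (map (tnth Q) (a ++ u ++ y)) (hQi _).
  rewrite map_cat word_prod_cat e es' prodP' => /(_ erefl).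
  by rewrite ec !size_cat /= !size_map !size_cat /=; lia.
(* Conjugation by the letter at [v] fixes that letter, which reduces this to [vc]. *)
have /count_memPn -> : tnth Q v \notin
    [seq (r ^ (tnth Q v)^-1)%g | r <- reflections (map (tnth Q) c)].
  apply: contra vc => /mapP[r rc e]; suff -> : tnth Q v = r by [].
  by apply: (@conjg_inj _ (tnth Q v)^-1%g); rewrite -e conjgE invgK mulgV mulg1.
(* Only the head of [v :: c] contributes, so the count for [b] is odd and hence positive. *)
rewrite eqxx => /odd_gt0; rewrite -has_count has_pred1 => /deletion.
move=> [u [w [y [eb e]]]].
have : w \in b by rewrite eb mem_cat mem_head orbT.
rewrite mem_filter => /andP[wP ws2]; have vw := lt2 _ ws2.
exists w; split=> //.
have ePw : enum ((v |: P) :\ w) = a ++ v :: u ++ y.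
  rewrite enum_set_filter es filter_cat /= !inE eqxx -val_eqE neq_ltn vw /=.
  congr (_ ++ _ :: _).
    apply: eq_in_filter => i /lt1 iv; rewrite !inE -!val_eqE.
    by rewrite (ltn_eqF (ltn_trans iv vw)) (ltn_eqF iv).
  (* As [b] has no repetitions, filtering out [w] and cutting [b] at [w] both give [rem w b]. *)
  have ub : uniq b.
    have := enum_uniq 'I_n; rewrite es cat_uniq /=.
    by move=> /and4P[_ _ _ /filter_uniq->].
  transitivity (rem w b); last first.
    have wu : w \notin u.
      by move: ub; rewrite eb cat_uniq /= negb_or => /and3P[_ /andP[]].
    rewrite remE eb index_cat (negbTE wu) /= eqxx addn0 take_size_cat //.
    by rewrite -cat_rcons drop_size_cat ?size_rcons.
  rewrite rem_filter // -filter_predI; apply: eq_in_filter => i /lt2 vi.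
  by rewrite !inE -(val_eqE i v) (gtn_eqF vi).
rewrite /represents /subword ePw; split=> //.
  by rewrite map_cat word_prod_cat /= word_prod_cons e mulVKg.
(* One letter enters and one leaves, so the length is still the minimal one of [P]. *)
move=> z hz /minP - /(_ hz).
by rewrite eb -!map_cat !size_map !size_cat /= size_cat addnS.
Qed.

(** * Facets of the subword complex *)

Lemma represents_card (W : groupType) (Sigma : W -> Prop) (n : nat)
    (Q : n.-tuple W) (pi : W) (P P' : {set 'I_n}) :
  represents Sigma Q P pi -> represents Sigma Q P' pi -> #|P| = #|P'|.
Proof.
move=> [wP pP mP] [wP' pP' mP'].
by apply/eqP; rewrite eqn_leq !cardE -!(size_map (tnth Q)) mP // mP'.
Qed.

Lemma represents_subset_eq (W : groupType) (Sigma : W -> Prop) (n : nat)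
    (Q : n.-tuple W) (pi : W) (P P' : {set 'I_n}) :
  represents Sigma Q P pi -> represents Sigma Q P' pi -> P \subset P' -> P = P'.
Proof.
move=> h h' sPP'; apply/eqP.
by rewrite eqEcard sPP' (represents_card h h') leqnn.
Qed.

Lemma subword_complexC (W : groupType) (Sigma : W -> Prop) (n : nat)
    (Q : n.-tuple W) (pi : W) (F : {set 'I_n}) :
  subword_complex Sigma Q pi (~: F) <-> contains Sigma Q F pi.
Proof.
by split=> [[P hP /setC_inj->]|hF] //; exists F.
Qed.

(** Sets representing [pi] have equal size, so none lies strictly inside another: they are the
    minimal sets containing [pi], and their complements the maximal faces. *)
Lemma facet_subword_complex (W : groupType) (Sigma : W -> Prop) (n : nat)
    (Q : n.-tuple W) (pi : W) (F : {set 'I_n}) :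
  facet (subword_complex Sigma Q pi) F <-> represents Sigma Q (~: F) pi.
Proof.
split=> [[[P [P' sP'P hP'] ->] maxF]|hF].
  rewrite setCK; have <- // : P' = P.
  apply: setC_inj; apply: maxF; last by rewrite setCS.
  by apply/subword_complexC; exists P'.
split; first by exists (~: F); rewrite ?setCK //; exists (~: F).
move=> G [P [P' sP'P hP'] ->]; rewrite -setCS setCK => sPF.
rewrite -[RHS]setCK; congr (~: _); apply/eqP; rewrite eqEsubset sPF.
by rewrite -(represents_subset_eq hP' hF (subset_trans sP'P sPF)).
Qed.

(** * Monomial ideals and their minimal generators *)

Lemma lepm_mesym1 (n : nat) (P P' : {set 'I_n}) :
  (mesym1 P <= mesym1 P')%MM = (P \subset P').
Proof.
apply/mnm_lepP/subsetP => h i; move/(_ i): h; rewrite !mnmE.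
  by move=> h iP; move: h; rewrite iP; case: (i \in P').
by case: (i \in P) => // ->.
Qed.

Lemma monomial_ideal_gen (k : fieldType) (n : nat) (M : 'X_{1..n} -> Prop) m :
  M m -> @monomial_ideal k n M 'X_[m].
Proof.
move=> Mm; exists [:: (1%R, m)]; split=> [p|].
  by rewrite inE => /eqP->.
by rewrite big_seq1 mul1r.
Qed.

(** If no generator divided the monomial, its coefficient in every combination of generators would
    be 0, yet here it is 1. *)
Lemma monomial_ideal_lepm (k : fieldType) (n : nat) (M : 'X_{1..n} -> Prop) m :
  @monomial_ideal k n M 'X_[m] -> exists2 m', M m' & (m' <= m)%MM.
Proof.
move=> [c [Mc e]]; apply: NNPP => hn.
have : mcoeff m ('X_[m] : {mpoly k[n]}) = 0%R; last first.
  by rewrite mcoeffX eqxx => /eqP; rewrite oner_eq0.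
rewrite e raddf_sum big_seq big1 // => p pc /=.
apply/eqP; rewrite mcoeff_eq0 (perm_mem (msuppMX _ _)).
apply/mapP => -[m' _ em]; apply: hn; exists p.2; first exact: Mc.
by rewrite em lem_addr.
Qed.

Lemma monomial_ideal_sub (k : fieldType) (n : nat)
    (M M' : 'X_{1..n} -> Prop) (f : {mpoly k[n]}) :
  (forall m, M m -> exists2 m', M' m' & (m' <= m)%MM) ->
  monomial_ideal M f -> monomial_ideal M' f.
Proof.
move=> hM [c [Mc ->]]; elim: c Mc => [|p c IHc] Mc.
  by exists [::]; rewrite !big_nil.
have [q qc|c' [Mc' e]] := IHc; first by apply: Mc; rewrite inE qc orbT.
have [m' Mm' le_m'] := hM _ (Mc p (mem_head _ _)).
exists ((p.1 * 'X_[p.2 - m'], m')%R :: c'); split=> [q|].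
  by rewrite inE => /orP[/eqP-> //|/Mc'].
by rewrite !big_cons e -mulrA -mpolyXD submK.
Qed.

(** The monomials of sets representing [pi] also generate the ideal. Divisibility both ways gives P2
    inside P1 inside P with P2 and P representing [pi], so all three agree and P is listed;
    minimality excludes further elements of [Ps]. *)
Lemma mem_minimal_generators (W : groupType) (Sigma : W -> Prop)
    (k : fieldType) (n : nat) (Q : n.-tuple W) (pi : W) (Ps : seq {set 'I_n}) :
  minimal_monomial_generators
    (stanley_reisner k (alexander_dual (subword_complex Sigma Q pi)))
    (fun m => m \in [seq mesym1 P | P : {set 'I_n} <- Ps]) ->
  forall P, P \in Ps <-> represents Sigma Q P pi.
Proof.
move=> [genI minI].
pose N m := exists2 P, represents Sigma Q P pi & m = mesym1 P.
have dualE F : ~ alexander_dual (subword_complex Sigma Q pi) F <->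
    contains Sigma Q F pi.
  rewrite /alexander_dual -subword_complexC.
  by split=> [/NNPP|hF]; last by apply.
have genN f :
    stanley_reisner k (alexander_dual (subword_complex Sigma Q pi)) f <->
    monomial_ideal N f.
  split; apply: monomial_ideal_sub => m [P hP ->].
    have /dualE[P' sP'P hP'] := hP.
    by exists (mesym1 P'); [exists P' | rewrite lepm_mesym1].
  exists (mesym1 P); last exact: lepm_refl.
  by exists P => //; apply/dualE; exists P.
have repPs P : represents Sigma Q P pi -> P \in Ps.
  move=> hP; have NP : N (mesym1 P) by exists P.
  have /genN/genI/monomial_ideal_lepm[m] := monomial_ideal_gen k NP.
  move=> /mapP[P1 P1Ps ->]; rewrite lepm_mesym1 => sP1P.
  have /genI/genN/monomial_ideal_lepm[m' [P2 hP2 ->]] :=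
    monomial_ideal_gen k (M := fun m => m \in [seq mesym1 P | P <- Ps])
      (map_f (@mesym1 n) P1Ps).
  rewrite lepm_mesym1 => sP2P1.
  have eP := represents_subset_eq hP2 hP (subset_trans sP2P1 sP1P).
  suff <- : P1 = P by [].
  by apply/eqP; rewrite eqEsubset sP1P -{1}eP.
move=> P; split=> [PPs|/repPs //].
have NPs m : N m -> m \in [seq mesym1 P | P <- Ps].
  by move=> [P' /repPs P'Ps ->]; apply: map_f.
by have [P' hP' /inj_mesym1->] := minI N NPs genN _ (map_f (@mesym1 n) PPs).
Qed.

(** * Lexicographic order on squarefree monomials *)

Lemma lex_gtP (n : nat) (P P' : {set 'I_n}) :
  reflect (exists v : 'I_n, [/\ v \in P, v \notin P'
             & forall i : 'I_n, i < v -> (i \in P') = (i \in P)])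
          (lex_gt (mesym1 P) (mesym1 P')).
Proof.
have eN (F : {set 'I_n}) i : tnth (mesym1 F) i = (i \in F) by exact: mnmE.
apply: (iffP (Order.TupleLexiOrder.ltxi_tuplePlt _ _)).
  case=> v lt_v; rewrite !eN => vPP'; exists v.
  split; try by move: vPP'; case: (v \in P); case: (v \in P').
  move=> i /lt_v; rewrite !eN.
  by case: (i \in P); case: (i \in P').
case=> v [vP vP' lt_v]; exists v => [i /lt_v|]; rewrite !eN; first by move->.
by rewrite vP (negbTE vP').
Qed.

Lemma lex_gt_trans (n : nat) : transitive (@lex_gt n).
Proof.
by move=> m2 m1 m3 h12 h23; apply: Order.POrderTheory.lt_trans h23 h12.
Qed.

Lemma lex_gt_irr (n : nat) : irreflexive (@lex_gt n).
Proof. by move=> m; apply: Order.POrderTheory.ltxx. Qed.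

(** * The shelling order *)

Theorem corollary4p1p3 (W : groupType) (Sigma : W -> Prop)
    (hW : coxeter_system Sigma) (k : fieldType) (n : nat) (Q : n.-tuple W)
    (hQ : is_word Sigma Q) (pi : W) (Ps : seq {set 'I_n})
    (hG : minimal_monomial_generators
            (stanley_reisner k
               (alexander_dual (subword_complex Sigma Q pi)))
            (fun m => m \in [seq mesym1 P | P : {set 'I_n} <- Ps]))
    (hlex : sorted (@lex_gt n) [seq mesym1 P | P : {set 'I_n} <- Ps]) :
  shelling (subword_complex Sigma Q pi) [seq ~: P | P <- Ps].
Proof.
have memPs := mem_minimal_generators hG.
have uPs : uniq Ps.
  exact: map_uniq (sorted_uniq (@lex_gt_trans n) (@lex_gt_irr n) hlex).
have ltPs i j : i < j -> j < size Ps ->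
    lex_gt (mesym1 (nth set0 Ps i)) (mesym1 (nth set0 Ps j)).
  move=> ij jPs; have iPs := ltn_trans ij jPs.
  rewrite -!(nth_map set0 (mesym1 set0)) //.
  by apply: (sorted_ltn_nth (@lex_gt_trans n) _ hlex); rewrite ?inE ?size_map.
split.
- move=> F G [P [P' sP' hP'] ->] sF; exists (~: F); last by rewrite setCK.
  by exists P' => //; rewrite (subset_trans sP') // -setCS setCK.
- move=> F G /facet_subword_complex hF /facet_subword_complex hG'.
  by rewrite cardsCs (represents_card hF hG') -cardsCs.
- split; first by rewrite (map_inj_uniq (@setC_inj _)).
  move=> F; rewrite facet_subword_complex -memPs.
  by rewrite -{1}[F]setCK mem_map //; exact: setC_inj.
move=> i j; rewrite size_map => /andP[ji iPs].
have jPs := ltn_trans ji iPs.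
rewrite !(nth_map set0) //.
have /lex_gtP[v [vPj vPi lt_v]] := ltPs _ _ ji iPs.
set Pi := nth set0 Ps i in vPi lt_v *; set Pj := nth set0 Ps j in vPj lt_v *.
have hPi : represents Sigma Q Pi pi by apply/memPs/mem_nth.
have hPj : represents Sigma Q Pj pi by apply/memPs/mem_nth.
have [w [wPi vw /memPs Pt]] := represents_exchange hW hQ hPi hPj vPj vPi lt_v.
(* The exchanged set represents [pi], so it is listed in [Ps]. *)
set t := index ((v |: Pi) :\ w) Ps.
have tPs : t < size Ps by rewrite index_mem.
have et : nth set0 Ps t = (v |: Pi) :\ w by rewrite nth_index.
have vw' : v != w by rewrite -val_eqE neq_ltn vw.
have gt_t : lex_gt (mesym1 (nth set0 Ps t)) (mesym1 Pi).
  apply/lex_gtP; exists v; rewrite et !inE eqxx vw'; split=> // l lv.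
  rewrite !inE -!val_eqE.
  by rewrite (ltn_eqF lv) (ltn_eqF (ltn_trans lv vw)).
exists v, t; split.
- by rewrite !inE vPj vPi.
(* The list is decreasing, so a set above [Pi] cannot stand at or after place [i]. *)
- rewrite ltnNge leq_eqVlt; apply/negP => /orP[/eqP e|/ltPs - /(_ tPs) lt_it].
    by move: gt_t; rewrite -e lex_gt_irr.
  by have := lex_gt_trans gt_t lt_it; rewrite lex_gt_irr.
(* The difference of complements is the exchanged set minus [Pi]. *)
- rewrite (nth_map set0) // et; apply/setP => l; rewrite !inE negbK.
  by have [->|lv] := eqVneq l v; rewrite ?vw' ?vPi //=;
     case: (l \in Pi); rewrite ?andbF.
Qed.
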